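(* Let $C\subset\mathbb{R}^n$ be a full-dimensional closed convex cone whose algebraic boundary is a smooth projective hypersurface in $\mathbb{P}^{n-1}$ defined by a homogeneous polynomial of degree $d$. If $n\ge4$, $d\ge3$ and $(n,d)\neq(4,4)$, then $C\cap\mathbb{Z}^n$ is not $(R,G)$-finitely generated.
   Context: The algebraic boundary of $C$ is the Zariski closure in $\mathbb{C}^n$ of the topological boundary of $C$; since $C$ is a cone, it is viewed as a projective hypersurface in $\mathbb{P}^{n-1}=\mathbb{P}(\mathbb{C}^n)$ defined by a single homogeneous polynomial, and it is called smooth if this polynomial defines a nonsingular hypersurface over $\mathbb{C}$. $\mathrm{GL}(n,\mathbb{Z})$ is the group of integer $n\times n$ matrices with determinant $\pm1$. For a convex cone $C\subseteq\mathbb{R}^n$ let $S_C:=C\cap\mathbb{Z}^n$. $S_C$ is called $(R,G)$-finitely generated if there exist a finite subset $R\subseteq S_C$ and a finitely generated subgroup $G\subseteq\mathrm{GL}(n,\mathbb{Z})$ acting linearly on $C$ (written $x\mapsto T\cdot x$) such that (1) $G\cdot C=C$ and $G\cdot S_C=S_C$, and (2) every $s\in S_C$ can be written as a finite sum $s=\sum_{i}\lambda_i\,T_i\cdot r_i$ with $r_i\in R$, $T_i\in G$, $\lambda_i\in\mathbb{Z}_{\ge0}$. ''Not $(R,G)$-finitely generated'' means no such pair exists. *)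

(* Defs.v *)
(* multinomials' mpoly is imported without its notations, which clash with
   those of MathComp-Analysis: [mpoly n K] is {mpoly K[n]}, [meval v p] is
   p.@[v], [ishomog1 d mdeg] is d.-homog and [mderiv i p] is the i-th partial
   derivative of p. *)
From HB Require Import structures.
From mathcomp Require Import all_boot all_order all_algebra.
From mathcomp Require Import complex.
From mathcomp Require Import boolp classical_sets functions cardinality reals.
From mathcomp Require Import topology normedtype.
From mathcomp Require Import -(notations) mpoly.

Set Implicit Arguments.
Unset Strict Implicit.
Unset Printing Implicit Defensive.

Import Order.TTheory GRing.Theory Num.Theory.
Import numFieldNormedType.Exports.

Local Open Scope classical_set_scope.
Local Open Scope ring_scope.

Section Cones.
Variables (R : realType) (n : nat).
Implicit Types C : set 'cV[R]_n.

Definition convex_cone C :=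
  C !=set0 /\
  forall (a b : R) (x y : 'cV[R]_n),
    0 <= a -> 0 <= b -> C x -> C y -> C (a *: x + b *: y).

(* The linear span of C is the whole space. *)
Definition full_dimensional C :=
  forall U : {vspace 'cV[R]_n}, (forall x, C x -> x \in U) -> U = fullv.

Definition boundary C : set 'cV[R]_n := closure C `\` interior C.

End Cones.

Section AlgebraicBoundary.

Definition peval (K : comNzRingType) (n : nat)
    (p : mpoly n K) (z : 'cV[K]_n) : K :=
  meval (fun i => z i ord0) p.

Definition zero_locus (K : comNzRingType) (n : nat) (p : mpoly n K) :
    set 'cV[K]_n :=
  [set z | peval p z = 0].

Definition zariski_closure (K : comNzRingType) (n : nat) (A : set 'cV[K]_n) :
    set 'cV[K]_n :=
  \bigcap_(p in [set p : mpoly n K | A `<=` zero_locus p]) zero_locus p.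

Definition algebraic_boundary (R : realType) (n : nat) (C : set 'cV[R]_n) :
    set 'cV[R[i]]_n :=
  zariski_closure (map_mx (real_complex R) @` boundary C).

Definition homogeneous (K : comNzRingType) (n d : nat) (f : mpoly n K) :=
  f \is ishomog1 d mdeg.

(* Jacobian criterion for {f = 0} in P^(n-1), on the affine cone. *)
Definition nonsingular (K : comNzRingType) (n : nat) (f : mpoly n K) :=
  forall z : 'cV[K]_n, z != 0 -> zero_locus f z ->
    exists i : 'I_n, peval (mderiv i f) z != 0.

(* The affine cone over the projective hypersurface {f = 0} is the Zariski
   closure in C^n; nonsingularity is that of f itself, i.e. scheme-theoretic,
   so it excludes powers of a defining polynomial. *)
Definition smooth_algebraic_boundary (R : realType) (n d : nat)
    (C : set 'cV[R]_n) :=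
  exists f : mpoly n R[i],
    [/\ homogeneous d f,
        algebraic_boundary C = zero_locus f
      & nonsingular f].

End AlgebraicBoundary.

Section FiniteGeneration.
Variables (R : realType) (n : nat).

Definition GLnZ : set 'M[int]_n := [set T | \det T = 1 \/ \det T = -1].

Definition is_subgroup (G : set 'M[int]_n) :=
  [/\ G `<=` GLnZ,
      G 1%:M,
      forall S T, G S -> G T -> G (S *m T)
    & forall T, G T -> G (invmx T)].

Definition fg_subgroup (G : set 'M[int]_n) :=
  is_subgroup G /\
  exists B : set 'M[int]_n, finite_set B /\ G = smallest is_subgroup B.

Definition act (T : 'M[int]_n) (x : 'cV[R]_n) : 'cV[R]_n :=
  map_mx intr T *m x.

Definition orbit_set (G : set 'M[int]_n) (A : set 'cV[R]_n) : set 'cV[R]_n :=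
  [set act T x | T in G & x in A].

Definition lattice_points (C : set 'cV[R]_n) : set 'cV[R]_n :=
  C `&` range (fun z : 'cV[int]_n => map_mx intr z).

Definition RG_generated_by
    (C Rt : set 'cV[R]_n) (G : set 'M[int]_n) :=
  [/\ finite_set Rt,
      Rt `<=` lattice_points C,
      fg_subgroup G,
      orbit_set G C = C /\
        orbit_set G (lattice_points C) = lattice_points C
    & forall s, lattice_points C s ->
        exists (k : nat) (r : 'I_k -> 'cV[R]_n) (T : 'I_k -> 'M[int]_n)
               (lam : 'I_k -> nat),
          (forall i, Rt (r i) /\ G (T i)) /\
          s = \sum_(i < k) act (T i) (r i) *+ lam i].

Definition RG_finitely_generated (C : set 'cV[R]_n) :=
  exists (Rt : set 'cV[R]_n) (G : set 'M[int]_n), RG_generated_by C Rt G.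

End FiniteGeneration.

(* Main.v *)
Require Import Defs.
From mathcomp Require Import all_boot all_order all_algebra.
From mathcomp Require Import complex.
From mathcomp Require Import boolp classical_sets cardinality reals.
From mathcomp Require Import topology normedtype.
From mathcomp Require Import -(notations) mpoly.
From mathcomp Require Import zify ring lra.
Import Order.TTheory GRing.Theory Num.Theory.
Import numFieldNormedType.Exports.
Local Open Scope classical_set_scope.
Local Open Scope ring_scope.

Set Implicit Arguments.
Unset Strict Implicit.
Unset Printing Implicit Defensive.

(** Let [f] be the smooth form of degree [d >= 3] that cuts out the algebraic
boundary, so that [grad f] vanishes only at the origin.  Every [T] in [G] maps
the zero set of [f] to itself.  On a line, a form with its zeros among those of
[f] has finitely many possible root multisets, so two of the forms
[f (T^k x)] are proportional and a power [A] of [T] satisfies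
[f (A x) = c f (x)].  Differentiating, [grad f (A x) A = c grad f (x)].  At an
eigenvector of eigenvalue [a] this makes [c / a^(d-1)] an eigenvalue too; since
[d - 1 >= 2] and the spectrum is finite with product [1] or [-1], all
eigenvalues are roots of unity, so a power [S] of [A] is unipotent.  If [S] were
not [1], comparing growth in [k] on both sides of
[grad f (S^k x) = grad f (x) S^-k] would give a contradiction.  Hence [G] is
torsion, and by Minkowski's congruence argument modulo 3 it is finite.  The
lattice points of [C] then lie in a finitely generated subcone; as their
positive multiples are dense in [C], the cone is polyhedral and its boundary
lies in finitely many hyperplanes.  Thus [f] is a product of linear forms, which
is singular where two of them vanish. *)

(** * Univariate polynomials *)

Section FormalLead.
Variable K : nzRingType.
Implicit Types (p q : {poly K}) (c e : K).

Definition formal_lead (a : nat) p c := (size p <= a.+1)%N /\ p`_a = c.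

Lemma formal_leadC c : formal_lead 0 c%:P c.
Proof. by split; rewrite ?coefC ?size_polyC //; case: (_ == _). Qed.

Lemma formal_leadX : formal_lead 1 'X 1.
Proof. by split; rewrite ?size_polyX ?coefX. Qed.

Lemma formal_leadW a b p c :
  (a < b)%N -> formal_lead a p c -> formal_lead b p 0.
Proof.
move=> ab [sp _]; split; last by rewrite nth_default // (leq_trans sp).
exact: leq_trans sp (leqW ab).
Qed.

Lemma formal_leadD a p q c e :
  formal_lead a p c -> formal_lead a q e -> formal_lead a (p + q) (c + e).
Proof.
move=> [sp <-] [sq <-]; split; last by rewrite coefD.
by rewrite (leq_trans (size_polyD _ _)) // geq_max sp sq.
Qed.

Lemma formal_leadZ a p c e :
  formal_lead a p c -> formal_lead a (e *: p) (e * c).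
Proof.
move=> [sp <-]; split; last by rewrite coefZ.
exact: leq_trans (size_scale_leq _ _) sp.
Qed.

Lemma formal_leadM a b p q c e :
  formal_lead a p c -> formal_lead b q e -> formal_lead (a + b) (p * q) (c * e).
Proof.
move=> [sp <-] [sq <-]; split.
  by apply: leq_trans (size_polyMleq _ _) _; lia.
have ltaab : (a < (a + b).+1)%N by lia.
rewrite coefM (bigD1 (Ordinal ltaab)) //= addKn big1 ?addr0 // => i.
rewrite -val_eqE /= neq_ltn => /orP[ltia|ltai].
  rewrite [X in _ * X]nth_default ?mulr0 //; apply: leq_trans sq _.
  by have := ltn_ord i; lia.
by rewrite [X in X * _]nth_default ?mul0r // (leq_trans sp).
Qed.

Lemma formal_lead_exp a p c k :
  formal_lead a p c -> formal_lead (a * k) (p ^+ k) (c ^+ k).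
Proof.
move=> pc; elim: k => [|k IHk].
  by rewrite muln0 !expr0; apply: formal_leadC.
by rewrite mulnS !exprS; apply: formal_leadM.
Qed.

Lemma formal_lead_prod (I : Type) (s : seq I) (a : I -> nat)
    (p : I -> {poly K}) (c : I -> K) :
  (forall i, formal_lead (a i) (p i) (c i)) ->
  formal_lead (\sum_(i <- s) a i)%N (\prod_(i <- s) p i) (\prod_(i <- s) c i).
Proof.
move=> pc; elim: s => [|i s IHs].
  by rewrite !big_nil; apply: formal_leadC.
by rewrite !big_cons; apply: formal_leadM.
Qed.

Lemma formal_lead_sum (I : Type) (s : seq I) (P : pred I) a
    (p : I -> {poly K}) (c : I -> K) :
  (forall i, P i -> formal_lead a (p i) (c i)) ->
  formal_lead a (\sum_(i <- s | P i) p i) (\sum_(i <- s | P i) c i).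
Proof.
move=> pc; elim/big_ind2: _ => //; first by split; rewrite ?size_poly0 ?coef0.
by move=> ? ? ? ?; apply: formal_leadD.
Qed.

Lemma formal_lead_affine c e : formal_lead 1 (c%:P + e *: 'X) e.
Proof.
rewrite -[X in formal_lead _ _ X]add0r -[X in formal_lead _ _ (_ + X)]mulr1.
apply: formal_leadD (formal_leadZ _ formal_leadX).
exact: formal_leadW (formal_leadC c).
Qed.

End FormalLead.

Lemma eq_poly_horner_nat (K : numDomainType) (p q : {poly K}) :
  (forall k : nat, p.[k%:R] = q.[k%:R]) -> p = q.
Proof.
move=> eqpq; apply/eqP; rewrite -subr_eq0.
apply/eqP/(@roots_geq_poly_eq0 _ _ [seq k%:R | k <- iota 0 (size (p - q))]).
- by apply/allP => _ /mapP[k _ ->]; rewrite rootE hornerD hornerN eqpq subrr.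
- by rewrite map_inj_uniq ?iota_uniq //; apply: (mulrIn (oner_neq0 _)).
- by rewrite size_map size_iota.
Qed.

Section NewtonPolynomial.
Variable K : numFieldType.
Implicit Type a : nat -> K.

Definition binomial_poly (j : nat) : {poly K} :=
  (j`!%:R)^-1 *: \prod_(i < j) ('X - i%:R%:P).

Definition newton_poly (m : nat) a : {poly K} :=
  \sum_(j < m.+1) a j *: binomial_poly j.

Lemma horner_binomial_poly j k : (binomial_poly j).[k%:R] = 'C(k, j)%:R.
Proof.
have horner_ffact :
    (\prod_(i < j) ('X - i%:R%:P : {poly K})).[k%:R] = (k ^_ j)%:R.
  elim: j => [|j IHj]; first by rewrite big_ord0 hornerC.
  rewrite big_ord_recr /= hornerM IHj ffactnSr natrM !hornerE.
  have [jk|kj] := leqP j k; first by rewrite natrB.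
  by rewrite ffact_small // !mul0r.
rewrite hornerZ horner_ffact -bin_ffact natrM mulrC mulfK //.
by rewrite pnatr_eq0 -lt0n fact_gt0.
Qed.

Lemma formal_lead_binomial_poly j :
  formal_lead j (binomial_poly j) (j`!%:R)^-1.
Proof.
rewrite -[X in formal_lead _ _ X]mulr1; apply: formal_leadZ.
have := @formal_lead_prod K _ (index_enum 'I_j) (fun=> 1%N)
  (fun i => 'X - i%:R%:P) (fun=> 1).
rewrite sum1_card card_ord big1_eq; apply => i.
rewrite -polyCN addrC -['X]scale1r; exact: formal_lead_affine.
Qed.

Lemma horner_newton_poly m a k :
  (newton_poly m a).[k%:R] = \sum_(j < m.+1) a j *+ 'C(k, j).
Proof.
rewrite horner_sum; apply: eq_bigr => j _.
by rewrite hornerZ horner_binomial_poly mulr_natr.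
Qed.

Lemma formal_lead_newton_poly m a :
  formal_lead m (newton_poly m a) (m`!%:R^-1 * a m).
Proof.
rewrite /newton_poly big_ord_recr /= -[X in formal_lead _ _ X]add0r mulrC.
apply: formal_leadD (formal_leadZ _ (formal_lead_binomial_poly m)).
have := @formal_lead_sum K _ (index_enum 'I_m) xpredT m
  (fun j => a j *: binomial_poly j) (fun=> 0).
rewrite big1_eq; apply => j _.
exact: formal_leadW (ltn_ord j) (formal_leadZ _ (formal_lead_binomial_poly j)).
Qed.

End NewtonPolynomial.

(** * Forms, gradients and restriction to lines *)

Definition dot (K : comNzRingType) n (l : 'rV[K]_n) (x : 'cV[K]_n) : K :=
  (l *m x) ord0 ord0.

Section LinearForms.
Variables (K : comNzRingType) (n : nat).
Implicit Types (l : 'rV[K]_n) (x y : 'cV[K]_n).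

Lemma dotE l x : dot l x = \sum_j l ord0 j * x j ord0.
Proof. exact: mxE. Qed.

Lemma dotDr l x y : dot l (x + y) = dot l x + dot l y.
Proof. by rewrite /dot mulmxDr mxE. Qed.

Lemma dotZr l a x : dot l (a *: x) = a * dot l x.
Proof. by rewrite /dot -scalemxAr mxE. Qed.

Lemma dotDl l l' x : dot (l + l') x = dot l x + dot l' x.
Proof. by rewrite /dot mulmxDl mxE. Qed.

Lemma dotZl a l x : dot (a *: l) x = a * dot l x.
Proof. by rewrite /dot -scalemxAl mxE. Qed.

Lemma dot0l x : dot 0 x = 0.
Proof. by rewrite /dot mul0mx mxE. Qed.

Lemma dot0r l : dot l 0 = 0.
Proof. by rewrite /dot mulmx0 mxE. Qed.

Lemma dot_delta_l i x : dot (delta_mx ord0 i) x = x i ord0.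
Proof. by rewrite /dot -rowE mxE. Qed.

Lemma dot_delta_r l i : dot l (delta_mx i ord0) = l ord0 i.
Proof. by rewrite /dot -colE mxE. Qed.

Lemma dot_mulmx m (l : 'rV_m) (A : 'M_(m, n)) x :
  dot l (A *m x) = dot (l *m A) x.
Proof. by rewrite /dot mulmxA. Qed.

Lemma dot_row m (A : 'M_(m, n)) i x : dot (row i A) x = (A *m x) i ord0.
Proof. by rewrite /dot -row_mul mxE. Qed.

Lemma eq_dot l l' : dot l =1 dot l' -> l = l'.
Proof. by move=> eql; apply/rowP => j; rewrite -!dot_delta_r. Qed.

Definition linear_form l : mpoly n K :=
  \sum_j l ord0 j *: mpolyX K (mnm1 j).

Lemma peval_linear_form l x : peval (linear_form l) x = dot l x.
Proof.
rewrite dotE /peval raddf_sum; apply: eq_bigr => j _.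
by rewrite /= mevalZ mevalXU.
Qed.

Lemma homogeneous_linear_form l : homogeneous 1 (linear_form l).
Proof.
apply: rpred_sum => j _; apply: dhomogZ.
by rewrite dhomogX; apply/eqP; exact: mdeg1.
Qed.

Definition comp_mx (p : mpoly n K) (A : 'M[K]_n) : mpoly n K :=
  comp_mpoly [tuple linear_form (row i A) | i < n] p.

Lemma peval_comp_mx p A x : peval (comp_mx p A) x = peval p (A *m x).
Proof.
rewrite /peval comp_mpoly_meval; apply: meval_eq => i.
by rewrite tnth_mktuple -/(peval _ x) peval_linear_form dot_row.
Qed.

Lemma homogeneous_comp_mx d p A :
  homogeneous d p -> homogeneous d (comp_mx p A).
Proof.
move=> /dhomogP homp; rewrite /homogeneous /comp_mx comp_mpolyE big_seq.
apply: rpred_sum => m /homp <-; rewrite /= mdegE; apply: dhomogZ.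
apply: (big_ind2 (fun q e => q \is ishomog1 e mdeg)); first exact: dhomog1.
  by move=> ? ? ? ?; apply: dhomogM.
move=> i _; rewrite tnth_mktuple.
by have := dhomogMn (m i) (homogeneous_linear_form (row i A)); rewrite mul1n.
Qed.

End LinearForms.

Section Substitution.
Variables (K : comNzRingType) (n : nat).
Implicit Types (f : mpoly n K) (P : 'I_n -> {poly K}).

Definition poly_subst P f : {poly K} := mmap (@polyC K) P f.

Lemma horner_poly_subst P f t :
  (poly_subst P f).[t] = meval (fun i => (P i).[t]) f.
Proof.
rewrite /poly_subst /mmap mevalE horner_sum; apply: eq_bigr => m _.
rewrite hornerM hornerC /mmap1 horner_prod; congr (_ * _).
by apply: eq_bigr => i _; rewrite horner_exp.
Qed.

Lemma deriv_poly_subst P f :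
  (poly_subst P f)^`() = \sum_i poly_subst P (mderiv i f) * (P i)^`().
Proof.
pose chain g :=
  (poly_subst P g)^`() = \sum_i poly_subst P (mderiv i g) * (P i)^`().
have chainM g h : chain g -> chain h -> chain (g * h).
  rewrite /chain /poly_subst => cg ch; rewrite rmorphM /= derivM cg ch.
  rewrite mulr_suml mulr_sumr -big_split /=; apply: eq_bigr => i _.
  by rewrite mderivM rmorphD !rmorphM /=; ring.
have chain1 : chain 1.
  rewrite /chain /poly_subst rmorph1 derivC big1 // => i _.
  by rewrite -mpolyC1 mderivC rmorph0 mul0r.
have chainX (i : 'I_n) : chain (mpolyX K (mnm1 i)).
  have subUU : mnm_sub (mnm1 i) (mnm1 i) = mnm0.
    by apply/mnmP => j; rewrite mnmBE mnm0E subnn.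
  rewrite /chain /poly_subst mmapX mmap1U (bigD1 i) //= big1 => [|j ji].
    by rewrite mderivX mnm1E eqxx scale1r subUU mmapX mmap11 mul1r addr0.
  by rewrite mderivX mnm1E eq_sym (negPf ji) scale0r rmorph0 mul0r.
have chain_monomial (m : multinom n) : chain (mpolyX K m).
  rewrite mpolyXE_id; elim/big_ind: _ => // i _.
  by elim: (m i) => [|k IHk]; rewrite ?expr0 // exprS; apply: chainM.
rewrite -/(chain f); elim/mpolyind: f => [|c m g _ _ IH].
  rewrite /chain /poly_subst rmorph0 deriv0 big1 // => i _.
  by rewrite mderiv0 rmorph0 mul0r.
move: IH (chain_monomial m); rewrite /chain /poly_subst rmorphD derivD /=.
move=> -> chm; rewrite mmapZ mul_polyC derivZ chm scaler_sumr -big_split.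
apply: eq_bigr => i _ /=.
by rewrite mderivD mderivZ rmorphD /= mmapZ mulrDl -!mul_polyC mulrA.
Qed.

Lemma formal_lead_poly_subst (m d : nat) P (z : 'cV[K]_n) f :
  homogeneous d f -> (forall i, formal_lead m (P i) (z i ord0)) ->
  formal_lead (m * d) (poly_subst P f) (peval f z).
Proof.
move=> /dhomogP homf leadP; rewrite /poly_subst /mmap /peval mevalE !big_seq.
apply: formal_lead_sum => u /homf <-.
rewrite /= mdegE big_distrr /= -[X in formal_lead X]add0n.
apply: formal_leadM (formal_leadC _) _.
by apply: formal_lead_prod => i; apply: formal_lead_exp.
Qed.

Lemma homogeneous_mderiv d f i :
  homogeneous d f -> homogeneous d.-1 (mderiv i f).
Proof.
move=> /dhomogP homf; apply/dhomogP => m.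
rewrite mcoeff_msupp mcoeff_mderiv => coef_neq0.
have : mnm_add m (mnm1 i) \in msupp f.
  by rewrite mcoeff_msupp; apply: contraNneq coef_neq0 => ->; rewrite mul0rn.
by move=> /homf; rewrite /= mdegD mdeg1 addn1 => <-.
Qed.

Lemma pevalZ d f a (z : 'cV[K]_n) :
  homogeneous d f -> peval f (a *: z) = a ^+ d * peval f z.
Proof.
move=> /dhomogP homf; rewrite /peval !mevalE mulr_sumr; apply: eq_big_seq => m.
move=> /homf <-; rewrite mulrCA /= mdegE expr_sum -big_split; congr (_ * _).
by apply: eq_bigr => i _; rewrite mxE exprMn.
Qed.

End Substitution.

Section Gradient.
Variables (K : comNzRingType) (n : nat).
Implicit Types (f g h : mpoly n K) (x v : 'cV[K]_n).

Definition grad f x : 'rV[K]_n := \row_i peval (mderiv i f) x.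

Lemma gradZ d f a x :
  homogeneous d f -> grad f (a *: x) = a ^+ d.-1 *: grad f x.
Proof.
move=> homf; apply/rowP => i.
by rewrite !mxE (pevalZ _ _ (homogeneous_mderiv i homf)).
Qed.

Lemma gradM g h x :
  grad (g * h) x = peval h x *: grad g x + peval g x *: grad h x.
Proof.
apply/rowP => i; rewrite !mxE mderivM /peval mevalD !mevalM.
by rewrite [in LHS]mulrC.
Qed.

Definition line f x v : {poly K} :=
  poly_subst (fun i => (x i ord0)%:P + v i ord0 *: 'X) f.

Lemma horner_line f x v t : (line f x v).[t] = peval f (x + t *: v).
Proof.
rewrite horner_poly_subst; apply: meval_eq => i.
by rewrite !mxE !hornerE mulrC.
Qed.

Lemma formal_lead_line d f x v :
  homogeneous d f -> formal_lead d (line f x v) (peval f v).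
Proof.
move=> homf; rewrite -[d]mul1n; apply: formal_lead_poly_subst => // i.
exact: formal_lead_affine.
Qed.

Lemma deriv_line f x v : (line f x v)^`().[0] = dot (grad f x) v.
Proof.
rewrite deriv_poly_subst horner_sum dotE; apply: eq_bigr => i _.
rewrite hornerM mxE horner_poly_subst; congr (_ * _).
  by apply: meval_eq => j; rewrite !hornerE.
by rewrite derivD derivC derivZ derivX !hornerE.
Qed.

End Gradient.

Section CharacteristicZero.
Variables (K : numDomainType) (n : nat).
Implicit Types (f p : mpoly n K) (x v : 'cV[K]_n).

Lemma grad_eq0 f : (forall x, peval f x = 0) -> forall x, grad f x = 0.
Proof.
move=> f0 x; apply: eq_dot => v; rewrite dot0l -deriv_line.
have -> : line f x v = 0.
  by apply: eq_poly_horner_nat => k; rewrite horner_line f0 horner0.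
by rewrite deriv0 horner0.
Qed.

Lemma peval0r p : peval p 0 = mcoeff mnm0 p.
Proof.
elim/mpolyind: p => [|c m p _ _ IHp]; first by rewrite /peval meval0 mcoeff0.
rewrite /peval mevalD mevalZ -/(peval p 0) IHp mcoeffD mcoeffZ mcoeffX mevalX.
congr (_ * _ + _); have [->|m_neq0] := eqVneq m mnm0.
  by rewrite big1 // => i _; rewrite mnm0E expr0.
apply/eqP/prodf_eq0; have [i mi] : exists i, m i != 0%N.
  apply/existsP; apply: contraNT m_neq0 => /existsPn m0.
  by apply/eqP/mnmP => i; rewrite mnm0E; apply/eqP; rewrite -[_ == _]negbK m0.
by exists i; rewrite // mxE expf_eq0 lt0n mi eqxx.
Qed.

(* The coefficient of a nonconstant monomial is, up to a positive integer, a
   coefficient of lower degree of a partial derivative. *)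
Lemma peval_eq0 p : (forall x, peval p x = 0) -> p = 0.
Proof.
move=> p0; apply/mpolyP => m; rewrite mcoeff0.
have [N] := ubnP (mdeg m); elim: N => // N IHN in m p p0 *.
rewrite ltnS => deg_m.
have [->|m_neq0] := eqVneq m mnm0; first by rewrite -peval0r p0.
have [i mi] : exists i, (0 < m i)%N.
  apply: contrapT => /forallNP m0; case/eqP: m_neq0; apply/mnmP => i.
  by rewrite mnm0E; apply/eqP; rewrite -leqn0 leqNgt; apply/negP/m0.
have subUK : mnm_add (mnm_sub m (mnm1 i)) (mnm1 i) = m.
  by apply/submK/mnm_lepP => j; rewrite mnm1E; case: eqP => // <-.
have mderiv_p0 x : peval (mderiv i p) x = 0.
  by have /rowP/(_ i) := grad_eq0 p0 x; rewrite !mxE.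
have deg_sub : (mdeg (mnm_sub m (mnm1 i)) < N)%N.
  by rewrite -addn1 -(mdeg1 i) -mdegD subUK.
have /eqP := IHN _ _ mderiv_p0 deg_sub.
by rewrite mcoeff_mderiv subUK mulrn_eq0 /= => /eqP.
Qed.

Lemma peval_neq0 p : p != 0 -> exists x, peval p x != 0.
Proof.
move=> /eqP p_neq0; apply: contrapT => /forallNP p0.
apply/p_neq0/peval_eq0 => x.
by apply: contrapT => /eqP; apply: p0.
Qed.

Lemma common_nonzero (I : finType) (p : I -> mpoly n K) :
  (forall i, p i != 0) -> exists x, forall i, peval (p i) x != 0.
Proof.
move=> p_neq0; have /peval_neq0[x] : \prod_i p i != 0 by apply/prodf_neq0.
by rewrite /peval rmorph_prod => /prodf_neq0 px; exists x => i; apply: px.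
Qed.

Lemma vanishing_factor (I : finType) (p : I -> mpoly n K) :
  (forall x, exists i, peval (p i) x = 0) -> exists i, p i = 0.
Proof.
move=> p0; apply: contrapT => /forallNP p_neq0.
have [i|x px] := @common_nonzero I p; first exact/eqP.
by have [i /eqP] := p0 x; rewrite (negPf (px i)).
Qed.

Lemma linear_form_eq0 (l : 'rV[K]_n) : linear_form l = 0 -> l = 0.
Proof.
move=> l0; apply: eq_dot => x.
by rewrite -peval_linear_form l0 /peval meval0 dot0l.
Qed.

Lemma grad_mulmx f (A : 'M_n) c x :
  (forall y, peval f (A *m y) = c * peval f y) ->
  grad f (A *m x) *m A = c *: grad f x.
Proof.
move=> fA; apply: eq_dot => v.
rewrite -dot_mulmx dotZl -!deriv_line.
have -> : line f (A *m x) (A *m v) = c *: line f x v.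
  apply: eq_poly_horner_nat => t; rewrite hornerZ !horner_line -fA.
  by rewrite mulmxDr scalemxAr.
by rewrite derivZ hornerZ.
Qed.

Lemma euler_identity d f x :
  homogeneous d f -> dot (grad f x) x = d%:R * peval f x.
Proof.
move=> homf; rewrite -deriv_line.
have -> : line f x x = (1 + 'X) ^+ d * (peval f x)%:P.
  apply: eq_poly_horner_nat => t; rewrite horner_line !hornerE.
  by rewrite -[in LHS](scale1r x) scalerA mulr1 -scalerDl (pevalZ _ _ homf).
rewrite derivM derivC mulr0 addr0 deriv_exp derivD derivC derivX add0r mul1r.
by rewrite hornerM hornerMn horner_exp !hornerE expr1n.
Qed.

Lemma grad_neq0 d f x :
  homogeneous d f -> (0 < d)%N -> nonsingular f -> x != 0 -> grad f x != 0.
Proof.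
move=> homf d_gt0 smoothf x_neq0; have [fx|fx] := eqVneq (peval f x) 0.
  have [j] := smoothf x x_neq0 fx; apply: contraNneq => /rowP/(_ j).
  by rewrite !mxE => ->.
apply: contra_neq fx => grad0; have := euler_identity x homf.
rewrite grad0 dot0l => /esym/eqP.
by rewrite mulf_eq0 pnatr_eq0 eqn0Ngt d_gt0 => /eqP.
Qed.

Lemma nonsingular_neq0 f : (0 < n)%N -> nonsingular f -> f != 0.
Proof.
move=> n_gt0 smoothf; apply/eqP => f0.
have [||j] := smoothf (const_mx 1); last first.
- by rewrite f0 mderiv0 /peval meval0 eqxx.
- by rewrite /zero_locus /= f0 /peval meval0.
apply/eqP => /colP/(_ (Ordinal n_gt0)); rewrite !mxE.
by apply/eqP; rewrite oner_neq0.
Qed.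

End CharacteristicZero.

Lemma seq_pigeonhole (T : eqType) (s : seq T) (g : nat -> T) :
  (forall k, g k \in s) ->
  exists k l, [/\ (k < l)%N, (l <= size s)%N & g k = g l].
Proof.
move=> gs; have : ~~ uniq (mkseq g (size s).+1).
  apply/negP => uniq_g.
  have /(uniq_leq_size uniq_g) : {subset mkseq g (size s).+1 <= s}.
    by move=> _ /mapP[k _ ->].
  by rewrite size_mkseq ltnn.
move=> /(uniqPn (g 0%N)) [k [l [ltkl]]]; rewrite size_mkseq => ltls.
by rewrite !nth_mkseq // ?(ltn_trans ltkl) // => eqg; exists k, l.
Qed.

Section LineFactorization.
Variables (K : numClosedFieldType) (n : nat).
Implicit Types (f g : mpoly n K) (x z v : 'cV[K]_n).

Lemma line_factorization d f x v :
  homogeneous d f -> peval f v != 0 ->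
  exists r : 'I_d -> K, forall t,
    peval f (x + t *: v) = peval f v * \prod_(j < d) (t - r j).
Proof.
move=> homf fv; have [size_le coefd] := formal_lead_line x v homf.
have size_line : size (line f x v) = d.+1.
  apply/eqP; rewrite eqn_leq size_le /= ltnNge.
  by apply: contra fv => /leq_sizeP/(_ d (leqnn _)); rewrite coefd => ->.
have [r line_r] := closed_field_poly_normal (line f x v).
have lead_line : lead_coef (line f x v) = peval f v.
  by rewrite lead_coefE size_line.
have size_r : size r = d.
  move: size_line.
  by rewrite line_r lead_line size_scale // size_prod_XsubC => -[].
subst d; exists (tnth (in_tuple r)) => t; rewrite -horner_line line_r lead_line.
rewrite hornerZ horner_prod big_tnth; congr (_ * _).
by apply: eq_bigr => j _; rewrite hornerXsubC.
Qed.

(* If the roots of [g] on the line through [x] of direction [v] are known up to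
   multiplicity, then [g x / g v] takes finitely many values. *)
Lemma peval_root_selection d e g x v (r : 'I_e -> K) :
  homogeneous d g -> peval g v != 0 ->
  (forall t, peval g (x + t *: v) = 0 -> exists i, t = r i) ->
  exists tau : {ffun 'I_d -> 'I_e},
    peval g x = peval g v * \prod_(j < d) - r (tau j).
Proof.
move=> homg gv roots_r; have [rg line_g] := line_factorization x homg gv.
have /choice[tau rg_tau] j : exists i, rg j = r i.
  by apply: roots_r; rewrite line_g (bigD1 j) //= subrr mul0r mulr0.
exists [ffun j => tau j]; have := line_g 0; rewrite scale0r addr0 => ->.
by congr (_ * _); apply: eq_bigr => j _; rewrite sub0r ffunE rg_tau.
Qed.

(* At each point [y] the pigeonhole principle gives a proportional pair, which
   [vanishing_factor] makes independent of [y]. *)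
Lemma proportional_forms d e f (h : nat -> mpoly n K) :
  f != 0 -> homogeneous e f -> (forall k, homogeneous d (h k)) ->
  (forall k, zero_locus (h k) `<=` zero_locus f) ->
  exists k l c, (k < l)%N /\ h l = c *: h k.
Proof.
move=> f_neq0 homf homh hf; have [v fv] := peval_neq0 f_neq0.
have hv k : peval (h k) v != 0 by apply: contra_neq fv => /hf.
pose T := {ffun 'I_d -> 'I_e}.
pose I := {p : 'I_#|T|.+1 * 'I_#|T|.+1 | (p.1 < p.2)%N}.
pose cross (p : I) := peval (h (val p).1) v *: h (val p).2
  - peval (h (val p).2) v *: h (val p).1.
have [y|[[k l] ltkl] /= /eqP] := @vanishing_factor _ _ _ cross; last first.
  rewrite subr_eq0 => /eqP prop; exists k, l, (peval (h l) v / peval (h k) v).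
  by split=> //; rewrite mulrC -scalerA -prop scalerA mulVf ?scale1r.
have [r line_f] := line_factorization y homf fv.
have /choice[tau h_tau] k : exists tau : T,
    peval (h k) y = peval (h k) v * \prod_(j < d) - r (tau j).
  apply: peval_root_selection => // t /hf.
  rewrite /zero_locus /= line_f => /eqP.
  rewrite mulf_eq0 (negPf fv) /= => /prodf_eq0[i _].
  by rewrite subr_eq0 => /eqP; exists i.
have [k|k [l []]] := @seq_pigeonhole _ (enum T) tau; first by rewrite mem_enum.
rewrite -cardT => ltkl lelT eq_tau.
have ltlT : (l < #|T|.+1)%N by rewrite ltnS.
exists (exist _ (Ordinal (ltn_trans ltkl ltlT), Ordinal ltlT) ltkl : I).
by rewrite /cross /peval /= mevalB !mevalZ -!/(peval _ y) !h_tau eq_tau; ring.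
Qed.

End LineFactorization.

(** * Hypersurfaces contained in hyperplane arrangements *)

Lemma common_kernel (F : fieldType) n (l1 l2 : 'rV[F]_n) :
  (3 <= n)%N -> exists z : 'cV[F]_n, [/\ z != 0, dot l1 z = 0 & dot l2 z = 0].
Proof.
move=> n_ge3; pose M := col_mx l1 l2.
have /rowV0Pn[u /sub_kermxP uM u_neq0] : kermx M^T != 0.
  rewrite kermx_eq0 /row_free neq_ltn.
  by rewrite (leq_ltn_trans (rank_leq_col _)).
exists u^T; rewrite trmx_eq0 u_neq0.
have : M *m u^T = 0 by rewrite -[M]trmxK -trmx_mul uM trmx0.
rewrite mul_col_mx -[0]vsubmxK => /eq_col_mx[].
by rewrite /dot => -> ->; rewrite !linear0 !mxE.
Qed.

Definition hyperplane_union (K : comNzRingType) n (L : seq 'rV[K]_n) :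
    set 'cV[K]_n :=
  [set z | exists2 l, l \in L & dot l z = 0].

Section HyperplaneArrangements.
Variables (K : numClosedFieldType) (n : nat).
Implicit Types (f : mpoly n K) (L : seq 'rV[K]_n).

Lemma product_of_linear_forms d f L :
  f != 0 -> homogeneous d f -> 0 \notin L ->
  zero_locus f `<=` hyperplane_union L ->
  exists c (l : 'I_d -> 'rV[K]_n), f = c *: \prod_(j < d) linear_form (l j).
Proof.
move=> f_neq0 homf L_neq0 fL.
pose factors o := if o is Some i then linear_form (tnth (in_tuple L) i) else f.
have [[i|] //|v factors_v] := @common_nonzero _ n _ factors.
  apply: contraNneq L_neq0 => /linear_form_eq0 <-.
  exact: (mem_tnth i (in_tuple L)).
have fv : peval f v != 0 := factors_v None.
have Lv i : dot (tnth (in_tuple L) i) v != 0.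
  by rewrite -peval_linear_form; exact: (factors_v (Some i)).
pose l (tau : {ffun 'I_d -> 'I_(size L)}) j := tnth (in_tuple L) (tau j).
pose c tau := peval f v / \prod_j dot (l tau j) v.
have [x|tau /eqP] := @vanishing_factor _ n _
    (fun tau => f - c tau *: \prod_j linear_form (l tau j)); last first.
  by rewrite subr_eq0 => /eqP; exists (c tau), (l tau).
have [t /fL[k kL]|tau ftau] := @peval_root_selection _ _ _ _ f x v
    (fun i => - (dot (tnth (in_tuple L) i) x / dot (tnth (in_tuple L) i) v))
    homf fv.
  have [i ->] := tnthP (in_tuple L) _ kL.
  rewrite dotDr dotZr => /eqP; rewrite addr_eq0 => /eqP dotx; exists i.
  by rewrite dotx mulNr opprK mulfK.
exists tau; rewrite /peval mevalB mevalZ rmorph_prod -!/(peval _ x) ftau.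
apply/eqP; rewrite subr_eq0 /c -mulrA; apply/eqP; congr (_ * _).
rewrite mulrC -prodf_div; apply: eq_bigr => j _.
by rewrite opprK -[in LHS]peval_linear_form.
Qed.

(* A product of at least two linear forms is singular where two of them
   vanish. *)
Lemma hypersurface_not_in_hyperplanes d f L :
  homogeneous d f -> (2 <= d)%N -> (3 <= n)%N -> nonsingular f ->
  0 \notin L -> ~ zero_locus f `<=` hyperplane_union L.
Proof.
move=> homf d_ge2 n_ge3 smoothf L_neq0 fL.
have f_neq0 : f != 0 by apply: nonsingular_neq0 smoothf; lia.
have [c [l f_prod]] := product_of_linear_forms f_neq0 homf L_neq0 fL.
have d_gt0 : (0 < d)%N by lia.
pose j0 := Ordinal d_gt0; pose j1 := Ordinal d_ge2.
have [z [z_neq0 l0z l1z]] := common_kernel (l j0) (l j1) n_ge3.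
have /eqP := grad_neq0 homf d_gt0 smoothf z_neq0; apply.
rewrite f_prod (bigD1 j0) //= scalerAr gradM.
rewrite peval_linear_form l0z scale0r addr0.
rewrite (bigD1 j1) //= /peval mevalZ mevalM -/(peval _ z) peval_linear_form l1z.
by rewrite mul0r mulr0 scale0r.
Qed.

End HyperplaneArrangements.

(** * Unipotent elements and torsion *)

Definition torsion (A : pzRingType) (x : A) :=
  exists2 M, (0 < M)%N & x ^+ M = 1.

Lemma common_exponent (A : pzRingType) (s : seq A) :
  (forall a, a \in s -> torsion a) ->
  exists2 N, (0 < N)%N & forall a, a \in s -> a ^+ N = 1.
Proof.
elim: s => [|a s IHs] torsion_s; first by exists 1%N.
have [N N_gt0 aN] := torsion_s a (mem_head _ _).
have [b bs|M M_gt0 sM] := IHs.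
  by apply: torsion_s; rewrite in_cons bs orbT.
exists (N * M)%N => [|b]; first by rewrite muln_gt0 N_gt0.
rewrite in_cons => /orP[/eqP->|/sM bM]; first by rewrite exprM aN expr1n.
by rewrite mulnC exprM bM expr1n.
Qed.

(* Iterating twice, [s] is stable under the [q]-th power with [q = e ^ 2]. *)
Lemma roots_of_unity_of_stable (F : fieldType) (s : seq F) e :
  (2 <= e)%N -> (forall u, u \in s -> u != 0 /\ u ^- e \in s) ->
  exists2 N, (0 < N)%N & forall u, u \in s -> u ^+ N = 1.
Proof.
move=> e_ge2 stable_s; apply: common_exponent => u us; pose q := (e * e)%N.
have [u_neq0 _] := stable_s u us.
have orbit_s k : u ^+ (q ^ k) \in s.
  elim: k => [|k /stable_s[_ /stable_s[_]]]; first by rewrite expn0 expr1.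
  by rewrite exprVn invrK -!exprM -expnSr.
have [k [l [ltkl _ eq_kl]]] := seq_pigeonhole orbit_s.
have ltq : (q ^ k < q ^ l)%N by rewrite ltn_exp2l // /q; nia.
exists (q ^ l - q ^ k)%N; first by rewrite subn_gt0.
apply: (mulIf (expf_neq0 (q ^ k) u_neq0)).
by rewrite mul1r -exprD subnK ?eq_kl // ltnW.
Qed.

Section Unipotent.
Variable A : pzRingType.
Implicit Types x y : A.

Definition unipotent x := exists k, (x - 1) ^+ k = 0.

Lemma expr_unipotent x m k :
  (x - 1) ^+ m.+1 = 0 -> x ^+ k = \sum_(j < m.+1) (x - 1) ^+ j *+ 'C(k, j).
Proof.
set N := x - 1 => N0; have {1}-> : x = N + 1 by rewrite subrK.
elim: k => [|k IHk].
  by rewrite big_ord_recl big1 ?addr0 // => j _; rewrite bin0n mulr0n.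
rewrite exprS IHk mulrDl mul1r mulr_sumr.
under [X in X + _]eq_bigr do rewrite mulrnAr -exprS.
rewrite [X in X + _]big_ord_recr /= N0 mul0rn addr0 [X in _ + X]big_ord_recl.
rewrite [RHS]big_ord_recl /= !bin0 addrCA -big_split /=; congr (_ + _).
by apply: eq_bigr => j _; rewrite binS mulrnDr addrC.
Qed.

Lemma unipotent_inverse x y k :
  x * y = 1 -> y * x = 1 -> (x - 1) ^+ k = 0 -> (y - 1) ^+ k = 0.
Proof.
move=> xy yx x0; have -> : y - 1 = - (y * (x - 1)).
  by rewrite mulrBr yx mulr1 opprB.
rewrite exprNn exprMn_comm ?x0 ?mulr0 // /GRing.comm.
by rewrite mulrBr mulrBl xy yx mulr1 mul1r.
Qed.

Lemma unipotent_nilpotency_index x :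
  unipotent x -> x != 1 ->
  exists m, [/\ (0 < m)%N, (x - 1) ^+ m != 0 & (x - 1) ^+ m.+1 = 0].
Proof.
move=> [k xk] x_neq1.
have ex_nil : exists k, (x - 1) ^+ k == 0 by exists k; apply/eqP.
case: (ex_minnP ex_nil) => -[|[|m]] /eqP nil_m min_m.
- by move: nil_m x_neq1; rewrite expr0 -[x]mulr1 => ->; rewrite mulr0 eqxx.
- by move: nil_m x_neq1; rewrite expr1 => /eqP; rewrite subr_eq0 => ->.
by exists m.+1; split=> //; apply/negP => /min_m; rewrite ltnn.
Qed.

Lemma unipotent_torsion x :
  (forall y M, (0 < M)%N -> y *+ M = 0 -> y = 0) ->
  unipotent x -> torsion x -> x = 1.
Proof.
move=> torsion_free unip_x [M M_gt0 xM]; apply/eqP.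
apply: contraT => /(unipotent_nilpotency_index unip_x).
set N := x - 1 => -[m [m_gt0 /eqP Nm NmS]]; case: Nm.
apply: torsion_free M_gt0 _.
have powM j : N ^+ m.-1 * x ^+ j = N ^+ m.-1 + N ^+ m *+ j.
  elim: j => [|j IHj]; first by rewrite expr0 mulr1 mulr0n addr0.
  have def_x : x = N + 1 by rewrite subrK.
  rewrite exprSr mulrA IHj def_x mulrDr mulr1 mulrDl mulrnAl -!exprSr.
  by rewrite prednK // NmS mul0rn addr0 addrCA -mulrS.
have := powM M; rewrite xM mulr1 => /eqP.
by rewrite eq_sym addrC -subr_eq0 addrK => /eqP.
Qed.

End Unipotent.

Lemma unipotent_orbit_newton (K : numFieldType) n p q m (S : 'M[K]_n)
    (X : 'M[K]_(p, n)) (Y : 'M[K]_(n, q)) i j k :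
  (S - 1) ^+ m.+1 = 0 ->
  (X *m S ^+ k *m Y) i j =
    (newton_poly m (fun l => (X *m (S - 1) ^+ l *m Y) i j)).[k%:R].
Proof.
move=> nilS; rewrite horner_newton_poly (expr_unipotent k nilS).
rewrite mulmx_sumr mulmx_suml summxE; apply: eq_bigr => l _.
by rewrite -scaler_nat -scalemxAr -scalemxAl mxE mulr_natl.
Qed.

Section MatrixPowers.
Variables (R : comUnitRingType) (n : nat).
Implicit Types A : 'M[R]_n.

Lemma det_mxX A k : \det (A ^+ k) = \det A ^+ k.
Proof.
elim: k => [|k IHk]; first by rewrite !expr0 det1.
by rewrite !exprS det_mulmx IHk.
Qed.

Lemma unitmxX A k : A \in unitmx -> A ^+ k \in unitmx.
Proof. by rewrite !unitmxE det_mxX; apply: unitrX. Qed.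

End MatrixPowers.

Section Eigenvalues.
Variables (F : fieldType) (n : nat).
Implicit Types A : 'M[F]_n.

Lemma eigenvalue_trmx A a : eigenvalue A^T a = eigenvalue A a.
Proof.
rewrite !eigenvalue_root_char /char_poly -det_tr; congr (root (\det _) a).
by apply/matrixP => i j; rewrite !mxE eq_sym.
Qed.

Lemma eigenvalue_colP A a :
  reflect (exists2 z : 'cV[F]_n, A *m z = a *: z & z != 0) (eigenvalue A a).
Proof.
rewrite -eigenvalue_trmx; apply: (iffP (eigenvalueP)) => -[z Az z_neq0].
  by exists z^T; rewrite ?trmx_eq0 // -[A]trmxK -trmx_mul Az linearZ.
by exists z^T; rewrite ?trmx_eq0 // -trmx_mul Az linearZ.
Qed.

Lemma eigenvalue_unit_neq0 A a : A \in unitmx -> eigenvalue A a -> a != 0.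
Proof.
move=> unitA /eigenvalueP[z zA z_neq0]; apply: contra_neq z_neq0 => a0.
by rewrite -[z](mulmxK unitA) zA a0 scale0r mul0mx.
Qed.

Lemma eigenvalue_unipotent A a : unipotent A -> eigenvalue A a -> a = 1.
Proof.
move=> [k Ak] /eigenvalueP[z zA z_neq0].
have zAk j : z *m (A - 1) ^+ j = (a - 1) ^+ j *: z.
  elim: j => [|j IHj]; first by rewrite !expr0 mulmx1 scale1r.
  rewrite exprSr mulmxA IHj -scalemxAl mulmxBr mulmx1 zA -{2}[z]scale1r.
  by rewrite -scalerBl scalerA -exprSr.
have /esym/eqP := zAk k; rewrite Ak mulmx0 scaler_eq0 (negPf z_neq0) orbF.
by rewrite expf_eq0 subr_eq0 => /andP[_ /eqP].
Qed.

End Eigenvalues.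

Section ClosedFieldSpectrum.
Variables (K : closedFieldType) (n : nat).
Implicit Types A : 'M[K]_n.

Lemma char_poly_split A :
  exists2 r : n.-tuple K, char_poly A = \prod_(a <- r) ('X - a%:P)
    & forall a, (a \in (r : seq K)) = eigenvalue A a.
Proof.
have [r def_r] := closed_field_poly_normal (char_poly A).
move: def_r; rewrite (monicP (char_poly_monic A)) scale1r => def_r.
have size_r : size r == n.
  by have := size_char_poly A; rewrite def_r size_prod_XsubC => -[->].
exists (Tuple size_r) => // a.
by rewrite eigenvalue_root_char def_r root_prod_XsubC.
Qed.

Lemma det_char_poly_split A (r : n.-tuple K) :
  char_poly A = \prod_(a <- r) ('X - a%:P) -> \det A = \prod_(a <- r) a.
Proof.
move=> def_r; have := char_poly_det A; rewrite def_r -horner_coef0 horner_prod.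
under eq_bigr do rewrite hornerXsubC sub0r -mulN1r.
rewrite big_split big_const_seq count_predT size_tuple iter_mulr_1 /=.
by move/mulfI => ->; rewrite // signr_eq0.
Qed.

Lemma det_expr_eigenvalue A N b :
  (forall a, eigenvalue A a -> a ^+ N = b) -> \det A ^+ N = b ^+ n.
Proof.
move=> eigN; have [r char_r mem_r] := char_poly_split A.
rewrite (det_char_poly_split char_r) -prodrXl.
rewrite (eq_big_seq (fun=> b)) => [|a]; last by rewrite mem_r => /eigN.
by rewrite big_const_seq count_predT iter_mulr_1 size_tuple.
Qed.

End ClosedFieldSpectrum.

Lemma dvdp_prod_roots_of_unity (F : fieldType) (s : seq F) M :
  (forall a, a \in s -> a ^+ M = 1) ->
  \prod_(a <- s) ('X - a%:P) %| ('X^M - 1%:P) ^+ size s.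
Proof.
elim: s => [|a s IHs] sM; first by rewrite big_nil expr0.
rewrite big_cons exprS dvdp_mul ?IHs //.
  by rewrite dvdp_XsubCl rootE !hornerE sM ?subrr ?mem_head.
by move=> b bs; apply: sM; rewrite in_cons bs orbT.
Qed.

Lemma eigenvalue_expr1_unipotent (K : closedFieldType) n (A : 'M[K]_n) M :
  (forall a, eigenvalue A a -> a ^+ M = 1) -> unipotent (A ^+ M).
Proof.
case: n A => [|n] A eigM.
  by exists 1%N; rewrite [LHS]flatmx0 [RHS]flatmx0.
have [r char_r mem_r] := char_poly_split A; exists n.+1.
have rM a : a \in (r : seq K) -> a ^+ M = 1 by rewrite mem_r => /eigM.
have := dvdp_prod_roots_of_unity rM; rewrite -char_r size_tuple.
move=> /dvdpP[q def_q]; have := congr1 (horner_mx A) def_q.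
rewrite rmorphM /= Cayley_Hamilton mulr0 rmorphXn /= rmorphB /= rmorphXn /=.
by rewrite horner_mx_X horner_mx_C.
Qed.

(** * Linear automorphisms of a smooth form *)

Definition semi_invariant (K : comNzRingType) n (f : mpoly n K) (c : K)
  (A : 'M[K]_n) := forall x, peval f (A *m x) = c * peval f x.

Lemma semi_invariantX (K : comNzRingType) n (f : mpoly n K) c (A : 'M[K]_n) k :
  semi_invariant f c A -> semi_invariant f (c ^+ k) (A ^+ k).
Proof.
move=> fA; elim: k => [|k IHk] x; first by rewrite !expr0 mul1mx mul1r.
by rewrite !exprS -mulmxE -mulmxA fA IHk mulrA.
Qed.

Lemma semi_invariant_power (K : numClosedFieldType) n d (f : mpoly n K)
    (A : 'M[K]_n) :
  f != 0 -> homogeneous d f -> A \in unitmx ->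
  (forall z, peval f (A *m z) = 0 -> peval f z = 0) ->
  exists2 m, (0 < m)%N & exists c, semi_invariant f c (A ^+ m).
Proof.
move=> f_neq0 homf unitA fA.
have [k|k z|k [l [c [ltkl fkl]]]] :=
    @proportional_forms _ _ d _ _ (fun k => comp_mx f (A ^+ k)) f_neq0 homf.
- exact: homogeneous_comp_mx.
- rewrite /zero_locus /= peval_comp_mx; elim: k z => [|k IHk] z.
    by rewrite expr0 mul1mx.
  by rewrite exprS -mulmxA => /fA/IHk.
exists (l - k)%N; [by rewrite subn_gt0 | exists c => x].
rewrite -[x](mulKVmx (unitmxX k unitA)); move: (_ *m x) => y.
rewrite mulmxA mulmxE -exprD subnK ?(ltnW ltkl) // -!peval_comp_mx fkl.
by rewrite /peval mevalZ.
Qed.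

Section SmoothForms.
Variables (K : numClosedFieldType) (n d : nat) (f : mpoly n K).
Hypotheses (n_gt0 : (0 < n)%N) (homf : homogeneous d f) (d_ge3 : (3 <= d)%N).
Hypothesis smoothf : nonsingular f.
Implicit Types (A S : 'M[K]_n) (e : 'cV[K]_n).

Lemma semi_invariant_neq0 A c : A \in unitmx -> semi_invariant f c A -> c != 0.
Proof.
move=> unitA fA.
have [v] := peval_neq0 (nonsingular_neq0 n_gt0 smoothf).
by apply: contra_neq => c0; rewrite -[v](mulKVmx unitA) fA c0 mul0r.
Qed.

Lemma eigenvalue_semi_invariant A c a :
  A \in unitmx -> semi_invariant f c A ->
  eigenvalue A a -> eigenvalue A (c / a ^+ d.-1).
Proof.
move=> unitA fA eig_a; have a_neq0 := eigenvalue_unit_neq0 unitA eig_a.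
have /eigenvalue_colP[z Az z_neq0] := eig_a.
have d_gt0 : (0 < d)%N by lia.
apply/eigenvalueP; exists (grad f z); last exact: grad_neq0 homf _ _ _.
have := grad_mulmx z fA; rewrite Az (gradZ _ _ homf) -scalemxAl => grad_z.
by rewrite mulrC -scalerA -grad_z scalerA mulVf ?scale1r // expf_neq0.
Qed.

(* After division by a [d]-th root of [c], the spectrum is stable under
   [u |-> u ^- d.-1], so all eigenvalues are roots of unity up to a common
   factor, which is itself a root of unity because of the determinant. *)
Lemma semi_invariant_unipotent_power A c :
  A \in unitmx -> \det A ^+ 2 = 1 -> semi_invariant f c A ->
  exists2 M, (0 < M)%N & unipotent (A ^+ M).
Proof.
move=> unitA detA fA; have c_neq0 := semi_invariant_neq0 unitA fA.
have d_gt0 : (0 < d)%N by lia.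
have [r _ mem_r] := char_poly_split A.
pose g := d.-root c; have gd : g ^+ d = c by apply: rootCK.
have g_neq0 : g != 0.
  by apply: contraNneq c_neq0 => g0; rewrite -gd g0 expr0n gtn_eqF.
have [||N N_gt0 rgN] := @roots_of_unity_of_stable _ [seq a / g | a <- r] d.-1.
- by lia.
- move=> u /mapP[a]; rewrite mem_r => eig_a ->.
  have a_neq0 := eigenvalue_unit_neq0 unitA eig_a.
  split; first by rewrite mulf_neq0 ?invr_neq0.
  apply/mapP; exists (c / a ^+ d.-1).
    by rewrite mem_r eigenvalue_semi_invariant.
  have def_c : c = g ^+ d.-1 * g by rewrite -exprSr prednK.
  by rewrite [c in RHS]def_c mulrAC mulfK // expr_div_n invf_div.
have eigN a : eigenvalue A a -> a ^+ N = g ^+ N.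
  rewrite -mem_r => /(map_f (fun a => a / g))/rgN.
  by rewrite expr_div_n => /divr1_eq.
have gN : (g ^+ N) ^+ (n * 2) = 1.
  by rewrite exprM -(det_expr_eigenvalue eigN) -exprM mulnC exprM detA expr1n.
exists (N * (n * 2))%N; first by rewrite !muln_gt0 N_gt0 n_gt0.
by apply: eigenvalue_expr1_unipotent => a /eigN aN; rewrite exprM aN.
Qed.

Lemma semi_invariant_unipotent A c :
  A \in unitmx -> unipotent A -> semi_invariant f c A -> c = 1.
Proof.
move=> unitA unipA fA; have [a eig_a] := eigenvalue_closed A n_gt0.
have := eigenvalue_semi_invariant unitA fA eig_a.
rewrite (eigenvalue_unipotent unipA eig_a) expr1n divr1.
exact: eigenvalue_unipotent.
Qed.

(* Along the orbit [S^k e] the gradient is polynomial in [k] of formal degree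
   [m * d.-1], with the value at [(S - 1)^m e / m!] as formal leading
   coefficient; but it equals [grad f e * S^-k], of degree at most [m]. *)
Lemma grad_unipotent_leading_term S m e :
  S \in unitmx -> semi_invariant f 1 S -> (0 < m)%N -> (S - 1) ^+ m.+1 = 0 ->
  grad f ((S - 1) ^+ m *m e) = 0.
Proof.
move=> unitS fS m_gt0 nilS; pose N := S - 1; pose N' := invmx S - 1.
have nilV : N' ^+ m.+1 = 0.
  by apply: unipotent_inverse nilS; [apply: mulmxV|apply: mulVmx].
have grad_orbit k : grad f (S ^+ k *m e) = grad f e *m invmx S ^+ k.
  elim: k => [|k IHk]; first by rewrite !expr0 mul1mx mulmx1.
  rewrite exprS -mulmxE -mulmxA -[LHS](mulmxK unitS) (grad_mulmx _ fS) scale1r.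
  by rewrite IHk -mulmxA mulmxE -exprSr.
pose P i : {poly K} :=
  newton_poly m (fun l => (1%:M *m N ^+ l *m e) i ord0).
pose Q i : {poly K} :=
  newton_poly m (fun l => (grad f e *m N' ^+ l *m 1%:M) ord0 i).
have substP i : poly_subst P (mderiv i f) = Q i.
  apply: eq_poly_horner_nat => k.
  rewrite -unipotent_orbit_newton // mulmx1 -grad_orbit mxE horner_poly_subst.
  by apply: meval_eq => l; rewrite -unipotent_orbit_newton // mul1mx.
apply/rowP => i; rewrite !mxE.
pose z := (m`!%:R)^-1 *: (N ^+ m *m e).
have leadP l : formal_lead m (P l) (z l ord0).
  by rewrite mxE -[N ^+ m]mul1mx; apply: formal_lead_newton_poly.
have [_] := formal_lead_poly_subst (homogeneous_mderiv i homf) leadP.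
have [sizeQ _] := formal_lead_newton_poly m
  (fun l => (grad f e *m N' ^+ l *m 1%:M) ord0 i).
rewrite substP nth_default => [/esym/eqP|]; last first.
  by apply: leq_trans sizeQ _; nia.
rewrite (pevalZ _ _ (homogeneous_mderiv i homf)) mulf_eq0 expf_eq0 invr_eq0.
by rewrite pnatr_eq0 (gtn_eqF (fact_gt0 m)) andbF => /eqP.
Qed.

Lemma unipotent_automorphism S c :
  S \in unitmx -> unipotent S -> semi_invariant f c S -> S = 1.
Proof.
move=> unitS unipS fS; apply/eqP.
apply: contraT => /(unipotent_nilpotency_index unipS)[m [m_gt0 /eqP Nm nilS]].
case: Nm; apply/matrixP => i j; rewrite [RHS]mxE.
have fS1 : semi_invariant f 1 S.
  by rewrite -(semi_invariant_unipotent unitS unipS fS).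
have := grad_unipotent_leading_term (delta_mx j ord0) unitS fS1 m_gt0 nilS.
rewrite -colE; have [/colP/(_ i)|] := eqVneq (col j ((S - 1) ^+ m)) 0.
  by rewrite !mxE.
by move=> /(grad_neq0 homf (ltnW (ltnW d_ge3)) smoothf)/eqP.
Qed.

Lemma automorphism_torsion A :
  A \in unitmx -> \det A ^+ 2 = 1 ->
  (forall z, peval f (A *m z) = 0 -> peval f z = 0) -> torsion A.
Proof.
move=> unitA detA fA.
have [m m_gt0 [c fm]] :=
  semi_invariant_power (nonsingular_neq0 n_gt0 smoothf) homf unitA fA.
have [||M M_gt0 unipM] := semi_invariant_unipotent_power _ _ fm.
- exact: unitmxX.
- by rewrite det_mxX -exprM mulnC exprM detA expr1n.
exists (m * M)%N; first by rewrite muln_gt0 m_gt0.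
rewrite exprM; apply: unipotent_automorphism unipM (semi_invariantX M fm).
by do 2!apply: unitmxX.
Qed.

End SmoothForms.

(** * Torsion groups of integer matrices *)

Lemma matrix_mulrn_eq0 (R : numDomainType) m n (N : 'M[R]_(m, n)) M :
  (0 < M)%N -> N *+ M = 0 -> N = 0.
Proof.
move=> M_gt0 /matrixP NM; apply/matrixP => i j; have := NM i j.
by rewrite mulmxnE !mxE => /eqP; rewrite mulrn_eq0 eqn0Ngt M_gt0 => /eqP.
Qed.

Section TorsionIntegerMatrices.
Variable n : nat.
Implicit Types (T B N : 'M[int]_n) (q : nat).

Lemma torsion_powers_bounded T :
  torsion T -> exists C, forall k i j, (`|(T ^+ k) i j| <= C)%N.
Proof.
move=> [M M_gt0 TM].
exists (\sum_(k < M) \sum_i \sum_j `|(T ^+ k) i j|)%N => k i j.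
have -> : T ^+ k = T ^+ (k %% M).
  by rewrite {1}(divn_eq k M) exprD mulnC exprM TM expr1n mul1r.
rewrite (bigD1 (Ordinal (ltn_pmod k M_gt0))) //= (bigD1 i) //= (bigD1 j) //=.
by rewrite -!addnA leq_addr.
Qed.

(* The entries of [(T - 1) ^+ k] are at most [2 ^ k * C] and divisible by
   [q ^ k], so they vanish for large [k]. *)
Lemma unipotent_of_bounded_powers T B q C :
  (3 <= q)%N -> (forall k i j, (`|(T ^+ k) i j| <= C)%N) -> T - 1 = B *+ q ->
  unipotent T.
Proof.
move=> q_ge3 boundT TB; set N := T - 1 in TB *.
have boundN k : forall l i j, (`|(N ^+ k * T ^+ l)%R i j| <= 2 ^ k * C)%N.
  elim: k => [|k IHk] l i j; first by rewrite expr0 mul1r expn0 mul1n.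
  have -> : N ^+ k.+1 * T ^+ l = N ^+ k * T ^+ l.+1 - N ^+ k * T ^+ l.
    by rewrite exprSr -mulrA -mulrBr /N mulrBl mul1r -exprS.
  have := IHk l.+1 i j; have := IHk l i j; rewrite !mxE expnS; lia.
have exp_growth k : (2 ^ k * (k + 2) <= 2 * q ^ k)%N.
  by elim: k => // k; rewrite !expnS; nia.
exists (2 * C)%N; rewrite -/N; apply/matrixP => i j.
rewrite [RHS]mxE; apply/eqP.
have := boundN (2 * C)%N 0%N i j; rewrite expr0 mulr1 TB exprMn_n mulmxnE.
have := exp_growth (2 * C)%N; set x := (B ^+ _) i j.
rewrite -mulr_natr abszM natz /= => growth bound.
have : (0 < 2 ^ (2 * C))%N by rewrite expn_gt0.
have [->|] := eqVneq x 0; first by rewrite mul0r.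
by rewrite -absz_gt0; nia.
Qed.

Lemma torsion_congruent_one T B q :
  (3 <= q)%N -> torsion T -> T - 1 = B *+ q -> T = 1.
Proof.
move=> q_ge3 torsT TB; have [C boundT] := torsion_powers_bounded torsT.
apply: unipotent_torsion torsT => [N M|]; first exact: matrix_mulrn_eq0.
exact: unipotent_of_bounded_powers q_ge3 boundT TB.
Qed.

Lemma GLnZ_unitmx T : GLnZ T -> T \in unitmx.
Proof. by rewrite unitmxE; case=> ->; rewrite ?unitrN1 ?unitr1. Qed.

Lemma torsion_subgroup_finite (G : set 'M[int]_n) :
  is_subgroup G -> (forall T, G T -> torsion T) -> finite_set G.
Proof.
move=> [GL G1 GM GV] torsionG.
pose residue T : 'M['I_3]_n := \matrix_(i, j) inord `|(T i j %% 3)%Z|.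
have residue_inj : {in G &, injective residue}.
  move=> S T; rewrite !inE => GS GT eq_res.
  have [B ST] : exists B : 'M[int]_n, S - T = B *+ 3.
    exists (map_mx (fun x => (x %/ 3)%Z) (S - T)); apply/matrixP => i j.
    have := congr1 (fun A : 'M['I_3]_n => val (A i j)) eq_res.
    by rewrite mulmxnE !mxE /= !inordK; lia.
  have unitT := GLnZ_unitmx (GL _ GT).
  suff ST1 : S *m invmx T = 1 by rewrite -[S](mulmxKV unitT) ST1 mul1mx.
  apply: (@torsion_congruent_one _ (B *m invmx T) 3) => //.
    exact/torsionG/GM/GV.
  have -> : (1 : 'M[int]_n) = T *m invmx T by rewrite mulmxV.
  by rewrite -mulmxBl ST -!scaler_nat scalemxAl.
by rewrite -(eq_finite_set (inj_card_eq residue_inj)); apply: finite_finset.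
Qed.

End TorsionIntegerMatrices.

(** * Polyhedral cones *)

Section PolyhedralCones.
Variables (R : realFieldType) (n : nat).
Implicit Types (x y v : 'cV[R]_n) (l : 'rV[R]_n).
Implicit Types (s : seq 'cV[R]_n) (L : seq 'rV[R]_n).

Definition polyhedral_cone L : set 'cV[R]_n :=
  [set x | forall l, l \in L -> 0 <= dot l x].

Fixpoint conic_hull s : set 'cV[R]_n :=
  if s is v :: s' then [set x | exists2 t, 0 <= t & conic_hull s' (x - t *: v)]
  else [set 0].

Lemma conic_hull0 s : conic_hull s 0.
Proof. by elim: s => //= v s IHs; exists 0; rewrite // scale0r subr0. Qed.

Lemma conic_hullD s x y :
  conic_hull s x -> conic_hull s y -> conic_hull s (x + y).
Proof.
elim: s x y => [|v s IHs] x y /=; first by move=> -> ->; rewrite addr0.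
move=> [t t_ge0 hullx] [u u_ge0 hully]; exists (t + u); first exact: addr_ge0.
by rewrite scalerDl opprD addrACA; apply: IHs.
Qed.

Lemma conic_hullZ s a x : 0 <= a -> conic_hull s x -> conic_hull s (a *: x).
Proof.
move=> a_ge0; elim: s x => [|v s IHs] x /=; first by move=> ->; rewrite scaler0.
move=> [t t_ge0 /IHs hullx]; exists (a * t); first exact: mulr_ge0.
by rewrite -scalerA -scalerBr.
Qed.

Lemma mem_conic_hull s v : v \in s -> conic_hull s v.
Proof.
elim: s => //= w s IHs; rewrite in_cons => /orP[/eqP->|/IHs hullv].
  by exists 1; rewrite // scale1r subrr; apply: conic_hull0.
by exists 0; rewrite // scale0r subr0.
Qed.

Lemma exists_between (lo hi : seq R) :
  (forall b, b \in hi -> 0 <= b) ->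
  (forall a b, a \in lo -> b \in hi -> a <= b) ->
  exists t, [/\ 0 <= t, forall a, a \in lo -> a <= t
    & forall b, b \in hi -> t <= b].
Proof.
move=> hi_ge0 le_lo_hi; exists (\big[Order.max/0]_(a <- lo) a).
split=> [|a lo_a|b hi_b]; first exact: bigmax_ge_id.
  exact: (le_bigmax_seq _ _ xpredT id).
rewrite big_seq; apply: bigmax_le => [|a lo_a]; first exact: hi_ge0.
exact: le_lo_hi.
Qed.

Definition fm_eliminate v L :=
  [seq l <- L | 0 <= dot l v] ++
  [seq dot h v *: l + (- dot l v) *: h |
    l <- [seq l <- L | dot l v < 0], h <- [seq l <- L | 0 < dot l v]].

Lemma fourier_motzkin v L x :
  (exists2 t, 0 <= t & polyhedral_cone L (x - t *: v)) <->
  polyhedral_cone (fm_eliminate v L) x.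
Proof.
have dotB l t : dot l (x - t *: v) = dot l x - t * dot l v.
  by rewrite -scaleNr dotDr dotZr mulNr.
split=> [[t t_ge0 Lx] l|Lx].
  have {}Lx h : h \in L -> 0 <= dot h x - t * dot h v.
    by move=> /Lx; rewrite dotB.
  rewrite mem_cat mem_filter => /orP[/andP[lv /Lx]|]; first by nra.
  move=> /allpairsP[[l1 l2] /= []]; rewrite !mem_filter.
  move=> /andP[l1v /Lx l1x] /andP[l2v /Lx l2x] ->; rewrite dotDl !dotZl; nra.
have Lx_ge0 l : l \in L -> 0 <= dot l v -> 0 <= dot l x.
  by move=> Ll lv; apply: Lx; rewrite mem_cat mem_filter lv Ll.
have Lx_pair l h : l \in L -> h \in L -> dot l v < 0 -> 0 < dot h v ->
    dot l x / dot l v <= dot h x / dot h v.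
  move=> Ll Lh lv hv.
  have : 0 <= dot (dot h v *: l + (- dot l v) *: h) x.
    apply: Lx; rewrite mem_cat; apply/orP; right.
    by apply: allpairs_f; rewrite mem_filter ?lv ?hv.
  rewrite dotDl !dotZl mulNr subr_ge0 => le_pair.
  rewrite ler_pdivlMr // mulrAC ler_ndivrMr //.
  by rewrite mulrC [X in _ <= X]mulrC.
pose ratios L' := [seq dot l x / dot l v | l <- L'].
have [||t [t_ge0 lo_t hi_t]] := @exists_between
    (ratios [seq l <- L | dot l v < 0]) (ratios [seq l <- L | 0 < dot l v]).
- move=> _ /mapP[l + ->]; rewrite mem_filter => /andP[lv Ll].
  by rewrite divr_ge0 ?Lx_ge0 // ltW.
- move=> _ _ /mapP[l + ->] /mapP[h + ->]; rewrite !mem_filter.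
  by move=> /andP[lv Ll] /andP[hv Lh]; apply: Lx_pair.
exists t => // l Ll; rewrite dotB subr_ge0.
have [lv|lv|lv] := ltrgt0P (dot l v); last by rewrite lv mulr0 Lx_ge0 ?lv.
  by rewrite -ler_pdivlMr //; apply/hi_t/map_f; rewrite mem_filter lv.
by rewrite -ler_ndivrMr //; apply/lo_t/map_f; rewrite mem_filter lv.
Qed.

Lemma conic_hull_polyhedral s : exists L, conic_hull s = polyhedral_cone L.
Proof.
elim: s => [|v s [L IHs]] /=; last first.
  exists (fm_eliminate v L); apply/predeqP => x.
  by rewrite /= IHs -fourier_motzkin.
pose E := [seq delta_mx ord0 i | i <- enum 'I_n] : seq 'rV[R]_n.
exists (E ++ [seq -1 *: l | l <- E]); apply/predeqP => x.
split=> [-> l _|Ex]; first by rewrite dot0r.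
apply/colP => i; rewrite mxE.
have Ei : delta_mx ord0 i \in E by rewrite map_f ?mem_enum.
have := Ex (delta_mx ord0 i); rewrite mem_cat Ei dot_delta_l => /(_ isT) xi_ge0.
have := Ex (-1 *: delta_mx ord0 i).
rewrite mem_cat (map_f _ Ei) orbT dotZl dot_delta_l => /(_ isT) xi_le0; lra.
Qed.

End PolyhedralCones.

(** * Closed convex cones and their lattice points *)

Lemma continuous_col (R : realType) n (T : topologicalType)
    (g : T -> 'cV[R]_n) :
  (forall i, continuous (fun t => g t i ord0)) -> continuous g.
Proof.
move=> cont_g t U /nbhs_ballP[e e_gt0 eU].
have : \forall u \near t, forall i, ball (g t i ord0) e (g u i ord0).
  apply: filter_forall => i; apply: cont_g; exact: nbhsx_ballx.
apply: filterS => u tu; apply: eU; split=> // i j; rewrite (ord1 j).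
exact: tu.
Qed.

Section ColumnContinuity.
Variables (R : realType) (n : nat).

Lemma continuous_dot (l : 'rV[R]_n) : continuous (dot l).
Proof.
have -> : dot l = fun x => \sum_j l ord0 j * x j ord0.
  by apply/funext => x; apply: dotE.
apply: continuous_big => [|j _ x]; first exact: add_continuous.
by apply: continuousM; [apply: cst_continuous|apply: coord_continuous].
Qed.

Lemma continuous_mulmx m (A : 'M[R]_(m, n)) :
  continuous (fun x : 'cV_n => A *m x).
Proof.
apply: continuous_col => i; under eq_fun do rewrite -dot_row.
exact: continuous_dot.
Qed.

Lemma scalar_dotE (phi : {scalar 'cV[R]_n}) :
  phi =1 dot (\row_j phi (delta_mx j ord0)).
Proof.
move=> x; rewrite [in LHS](matrix_sum_delta x) linear_sum dotE.
by apply: eq_bigr => j _; rewrite big_ord1 linearZ mxE mulrC.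
Qed.

Lemma rational_point_nbhs (x : 'cV[R]_n) (U : set 'cV[R]_n) :
  nbhs x U ->
  exists (M : nat) (z : 'cV[int]_n), U (M.+1%:R^-1 *: map_mx intr z).
Proof.
move=> /nbhs_ballP[e e_gt0 eU]; have [M] := ltr_add_invr e_gt0.
rewrite add0r => Me; exists M, (\col_i Num.floor (M.+1%:R * x i ord0)).
apply: eU; split=> // i j; rewrite (ord1 j) -ball_normE /= !mxE.
apply: le_lt_trans Me; set a := M.+1%:R * _.
have M_neq0 : M.+1%:R != 0 :> R by rewrite pnatr_eq0.
have -> : x i ord0 = M.+1%:R^-1 * a by rewrite mulKf.
rewrite -mulrBr normrM gtr0_norm ?invr_gt0 ?ltr0n // ler_piMr ?invr_ge0 //.
by have := floor_itv a; rewrite intrD ler_norml; lra.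
Qed.

End ColumnContinuity.

Lemma exists_seq_span (K : fieldType) (vT : vectType K) (A : set vT) :
  exists2 s : seq vT, [set` s] `<=` A & forall x, A x -> x \in <<s>>%VS.
Proof.
pose P k := `[< exists2 s : seq vT, [set` s] `<=` A & \dim <<s>>%VS = k >].
have exP : exists k, P k.
  exists (\dim <<[::] : seq vT>>%VS); apply/asboolP.
  by exists [::] => // v; rewrite /= in_nil.
have boundP k : P k -> (k <= \dim {:vT})%N.
  by move=> /asboolP[s _ <-]; apply/dimvS/subvf.
case: (ex_maxnP exP boundP) => k /asboolP[s sA dim_s] k_max.
exists s => // x Ax; have dim_le : (\dim <<x :: s>>%VS <= \dim <<s>>%VS)%N.
  rewrite dim_s; apply/k_max/asboolP; exists (x :: s) => // v.
  by rewrite /= in_cons => /orP[/eqP->|/sA].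
suff -> : <<s>>%VS = <<x :: s>>%VS by rewrite memv_span // mem_head.
by apply/eqP; rewrite eqEdim dim_le span_cons addvSr.
Qed.

Section ConvexCones.
Variables (R : realType) (n : nat).
Implicit Types (C : set 'cV[R]_n) (x y p : 'cV[R]_n).

Lemma convex_cone0 C : convex_cone C -> C 0.
Proof.
move=> [[x Cx] CC]; have := CC 0 0 _ _ (lexx _) (lexx _) Cx Cx.
by rewrite !scale0r addr0.
Qed.

Lemma convex_coneD C x y : convex_cone C -> C x -> C y -> C (x + y).
Proof.
move=> [_ CC] Cx Cy; have := CC 1 1 _ _ ler01 ler01 Cx Cy.
by rewrite !scale1r.
Qed.

Lemma convex_coneZ C a x : convex_cone C -> 0 <= a -> C x -> C (a *: x).
Proof.
move=> CC a_ge0 Cx; have C0 := convex_cone0 CC; case: CC => _ CC.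
by have := CC a 0 x 0 a_ge0 (lexx _) Cx C0; rewrite scaler0 addr0.
Qed.

Lemma conic_hull_sub C (s : seq 'cV[R]_n) :
  convex_cone C -> [set` s] `<=` C -> conic_hull s `<=` C.
Proof.
move=> CC; elim: s => [_ x ->|v s IHs sC x [t t_ge0 hullx]].
  exact: convex_cone0.
rewrite -[x](subrK (t *: v)); apply: convex_coneD => //.
  by apply: IHs hullx => w ws; apply: sC; rewrite /= in_cons ws orbT.
by apply: convex_coneZ => //; apply: sC; rewrite /= mem_head.
Qed.

Lemma nbhs_convex_cone_shift C x p t :
  convex_cone C -> C x -> nbhs p C -> 0 < t -> nbhs (x + t *: p) C.
Proof.
move=> CC Cx /nbhs_ballP[e e_gt0 eC] t_gt0; apply/nbhs_ballP.
exists (t * e) => [|y [_ xpy]]; first exact: mulr_gt0.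
have -> : y = x + t *: (t^-1 *: (y - x)).
  by rewrite scalerA divff ?gt_eqF // scale1r addrC subrK.
apply: convex_coneD => //; apply: convex_coneZ; rewrite ?ltW //.
apply: eC; split=> // i j; have := xpy i j; rewrite -!ball_normE /= !mxE.
have -> : p i j - t^-1 * (y i j - x i j) = t^-1 * (x i j + t * p i j - y i j).
  by field; rewrite gt_eqF.
by rewrite normrM gtr0_norm ?invr_gt0 // ltr_pdivrMl.
Qed.

Lemma convex_cone_closure_interior C :
  convex_cone C -> C° !=set0 -> C `<=` closure C°.
Proof.
move=> CC [p Cp] x Cx U xU.
have cont : continuous (fun t : R => x + t *: p).
  apply: continuous_col => i; under eq_fun do rewrite !mxE.
  move=> t; apply: cvgD; first exact: cvg_cst.
  by apply: cvgM; [exact: cvg_id|exact: cvg_cst].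
have /cont/nbhs_ballP[e e_gt0 eU] : nbhs (x + 0 *: p) U.
  by rewrite scale0r addr0.
exists (x + (e / 2) *: p); split.
  by apply: nbhs_convex_cone_shift; rewrite ?divr_gt0.
apply: eU; rewrite -ball_normE /= sub0r normrN gtr0_norm ?divr_gt0 //.
by rewrite ltr_pdivrMr // ltr_pMr // ltr1n.
Qed.

Lemma full_dimensional_interior C :
  convex_cone C -> full_dimensional C -> C° !=set0.
Proof.
move=> CC fullC; have [s sC spanC] := exists_seq_span C.
have full_s : <<s>>%VS = fullv by apply: fullC.
pose X := in_tuple s; pose a := coord X.
have coord_s y : y = \sum_(i < size s) a i y *: X`_i.
  by apply: coord_span; rewrite full_s memvf.
exists (\sum_(i < size s) X`_i); set p := \sum_(i < _) _.
have coord_near i : \forall y \near p, a i p - 1 < a i y.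
  have -> : a i = dot (\row_j a i (delta_mx j ord0)).
    by apply/funext => y; apply: scalar_dotE.
  by apply: (cvgr_gt _ (@continuous_dot _ _ _ p)); rewrite ltrBlDr ltrDl.
have := filter_forall (nbhs_filter p) coord_near; apply: filterS => y a_gt.
have -> : y = \sum_(i < size s) (1 + a i (y - p)) *: X`_i.
  under eq_bigr do rewrite scalerDl scale1r.
  by rewrite big_split /= -coord_s -/p addrC subrK.
apply: (big_ind C) => [|? ?|i _]; [exact: convex_cone0|exact: convex_coneD|].
apply: convex_coneZ => //; last by apply/sC/mem_nth.
by have := a_gt i; rewrite /a linearB /=; lra.
Qed.

Lemma dot_ge0_lattice_points C (l : 'rV[R]_n) :
  convex_cone C -> C° !=set0 ->
  (forall x, lattice_points C x -> 0 <= dot l x) ->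
  forall x, C x -> 0 <= dot l x.
Proof.
move=> CC intC l_ge0 x Cx; rewrite leNgt; apply/negP => lx.
have [y [Cy ly]] : C° `&` [set y | dot l y < 0] !=set0.
  apply: (convex_cone_closure_interior CC intC Cx).
  exact: cvgr_lt _ (@continuous_dot _ _ l x) _ lx.
have [M [z [Cz lz]]] : exists (M : nat) (z : 'cV[int]_n),
    (C `&` [set y | dot l y < 0]) (M.+1%:R^-1 *: map_mx intr z).
  apply: (@rational_point_nbhs _ _ y); apply: filterI => //.
  exact: cvgr_lt _ (@continuous_dot _ _ l y) _ ly.
have M_gt0 : 0 < M.+1%:R :> R by rewrite ltr0n.
have : 0 <= dot l (map_mx intr z).
  apply: l_ge0; split; last by exists z.
  rewrite -[map_mx _ _](scalerK (lt0r_neq0 M_gt0)).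
  rewrite scalerA -mulrC -scalerA; apply: convex_coneZ => //; exact: ltW.
by move: lz; rewrite /= dotZr pmulr_rlt0 ?invr_gt0 // leNgt => ->.
Qed.

Lemma lattice_generated_polyhedral C (s : seq 'cV[R]_n) :
  convex_cone C -> full_dimensional C -> [set` s] `<=` C ->
  lattice_points C `<=` conic_hull s -> exists L, C = polyhedral_cone L.
Proof.
move=> CC fullC sC lattice_s; have [L hull_s] := conic_hull_polyhedral s.
exists L; apply/seteqP; split=> [x Cx l Ll|]; last first.
  by rewrite -hull_s; apply: conic_hull_sub.
apply: (dot_ge0_lattice_points CC) Cx => [|y /lattice_s].
  exact: full_dimensional_interior.
by rewrite hull_s; apply.
Qed.

Lemma closed_polyhedral_cone (L : seq 'rV[R]_n) : closed (polyhedral_cone L).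
Proof.
have -> : polyhedral_cone L =
    \bigcap_(l in [set` L]) (dot l @^-1` [set t | 0 <= t]) by [].
apply: closed_bigI => l _.
have /continuous_closedP := @continuous_dot _ _ l; apply; exact: closed_ge.
Qed.

Lemma boundary_polyhedral_cone (L : seq 'rV[R]_n) :
  boundary (polyhedral_cone L) `<=` hyperplane_union [seq l <- L | l != 0].
Proof.
move=> x [/closed_polyhedral_cone Lx not_int]; apply: contrapT => no_l.
apply: not_int; have near_L (i : 'I_(size L)) :
    \forall y \near x, 0 <= dot (tnth (in_tuple L) i) y.
  set l := tnth _ _; have Ll : l \in L by apply: mem_tnth.
  have [->|l_neq0] := eqVneq l 0; first by apply: filterE => y; rewrite dot0l.
  have lx : 0 < dot l x.
    rewrite lt_neqAle Lx // andbT eq_sym; apply/eqP => lx0.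
    by apply: no_l; exists l; rewrite // mem_filter l_neq0.
  exact: cvgr_ge _ (@continuous_dot _ _ l x) _ lx.
have := filter_forall (nbhs_filter x) near_L.
by apply: filterS => y Ly l /(tnthP (in_tuple L))[i ->].
Qed.

End ConvexCones.

(** * The group action on the algebraic boundary *)

Lemma zariski_closure_mulmx (K : comNzRingType) n (A : 'M[K]_n)
    (E : set 'cV[K]_n) z :
  (forall x, E x -> E (A *m x)) ->
  zariski_closure E z -> zariski_closure E (A *m z).
Proof.
move=> EA Ez p Ep; rewrite /zero_locus /= -peval_comp_mx; apply: Ez => x Ex.
by rewrite /zero_locus /= peval_comp_mx; apply/Ep/EA.
Qed.

Lemma zariski_closure_hyperplanes (K : idomainType) n (L : seq 'rV[K]_n)
    (E : set 'cV[K]_n) :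
  E `<=` hyperplane_union L -> zariski_closure E `<=` hyperplane_union L.
Proof.
have peval_prod x :
    peval (\prod_(l <- L) linear_form l) x = \prod_(l <- L) dot l x.
  rewrite /peval rmorph_prod; apply: eq_bigr => l _.
  exact: peval_linear_form.
move=> EL z Ez; have /eqP : \prod_(l <- L) dot l z = 0.
  rewrite -peval_prod; apply: Ez => x /EL[l Ll lx].
  rewrite /zero_locus /= peval_prod; apply/eqP; rewrite prodf_seq_eq0.
  by apply/hasP; exists l; rewrite ?lx /=.
by rewrite prodf_seq_eq0 => /hasP[l Ll /eqP]; exists l.
Qed.

Section GroupAction.
Variables (R : realType) (n : nat) (C : set 'cV[R]_n) (G : set 'M[int]_n).
Hypotheses (C_closed : closed C) (G_group : is_subgroup G).
Hypothesis GC : orbit_set G C = C.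

Lemma subgroup_unitmx T : G T -> T \in unitmx.
Proof. by case: G_group => GL _ _ _ /GL/GLnZ_unitmx. Qed.

Lemma subgroup_act T x : G T -> C x -> C (act T x).
Proof. by move=> GT Cx; rewrite -GC; exists T => //; exists x. Qed.

Lemma map_invmxK (F : pzRingType) T (x : 'cV[F]_n) :
  T \in unitmx -> map_mx intr (invmx T) *m (map_mx intr T *m x) = x.
Proof.
by move=> unitT; rewrite mulmxA -map_mxM mulVmx // map_mx1 mul1mx.
Qed.

Lemma subgroup_boundary T x : G T -> boundary C x -> boundary C (act T x).
Proof.
move=> GT [clx not_int]; have [_ _ _ GV] := G_group; split.
  by apply: subset_closure; apply: subgroup_act => //; apply: C_closed.
move=> intTx; apply: not_int.
have : nbhs x [set y | C (act T y)] by exact: continuous_mulmx intTx.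
apply: filterS => y Cy.
rewrite -(map_invmxK y (subgroup_unitmx GT)).
by apply: subgroup_act => //; apply: GV.
Qed.

Lemma subgroup_zero_locus (f : mpoly n R[i]) T (z : 'cV[R[i]]_n) :
  algebraic_boundary C = zero_locus f -> G T ->
  peval f (map_mx intr T *m z) = 0 -> peval f z = 0.
Proof.
move=> Cf GT fTz; have [_ _ _ GV] := G_group.
have : zero_locus f (map_mx intr T *m z) by [].
rewrite -Cf => /(@zariski_closure_mulmx _ _ (map_mx intr (invmx T))).
rewrite map_invmxK ?subgroup_unitmx // -/(algebraic_boundary C) Cf; apply.
move=> _ [x bx <-]; exists (act (invmx T) x).
  by apply: subgroup_boundary => //; apply: GV.
rewrite /act map_mxM -map_mx_comp; congr (_ *m _).
by apply/matrixP => i j; rewrite !mxE /= rmorph_int.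
Qed.

Lemma subgroup_torsion d (f : mpoly n R[i]) T :
  (0 < n)%N -> homogeneous d f -> (3 <= d)%N -> nonsingular f ->
  algebraic_boundary C = zero_locus f -> G T -> torsion T.
Proof.
move=> n_gt0 homf d_ge3 smoothf Cf GT; pose A : 'M[R[i]]_n := map_mx intr T.
have detA : \det A ^+ 2 = 1.
  case: G_group => GL _ _ _; rewrite /A det_map_mx.
  by case: (GL _ GT) => ->; rewrite ?rmorphN rmorph1 ?sqrrN expr1n.
have unitA : A \in unitmx.
  by rewrite unitmxE -(unitrX_pos _ (ltn0Sn 1)) detA unitr1.
have [M M_gt0 AM] := automorphism_torsion n_gt0 homf d_ge3 smoothf unitA detA
  (fun z => subgroup_zero_locus Cf GT).
exists M => //; have : map_mx intr (T ^+ M) = map_mx intr 1 :> 'M[R[i]]_n.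
  by rewrite rmorphXn rmorph1.
move=> /matrixP TM; apply/matrixP => i j; have := TM i j.
by rewrite mxE [RHS]mxE => /intr_inj.
Qed.

End GroupAction.

Lemma RG_generated_polyhedral (R : realType) n (C Rt : set 'cV[R]_n)
    (G : set 'M[int]_n) :
  convex_cone C -> full_dimensional C -> RG_generated_by C Rt G ->
  finite_set G -> exists L, C = polyhedral_cone L.
Proof.
move=> CC fullC [finR RtC _ [GC _] gen] finG.
have /finite_seqP[s def_s] : finite_set [set act T r | T in G & r in Rt].
  exact: finite_image2.
apply: (@lattice_generated_polyhedral _ _ _ s) => // [v|x].
  by rewrite -def_s => -[T GT [r /RtC[Cr _] <-]]; apply: (subgroup_act GC).
move=> /gen[k [r [T [lam [rT ->]]]]].
apply: (big_ind (conic_hull s)) => [|? ?|i _].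
- exact: conic_hull0.
- exact: conic_hullD.
rewrite -scaler_nat; apply: conic_hullZ => //; apply: mem_conic_hull.
have [Ri Gi] := rT i; suff : [set` s] (act (T i) (r i)) by [].
by rewrite -def_s; exists (T i) => //; exists (r i).
Qed.

Lemma algebraic_boundary_polyhedral (R : realType) n (L : seq 'rV[R]_n) :
  exists2 L' : seq 'rV[R[i]]_n, 0 \notin L'
    & algebraic_boundary (polyhedral_cone L) `<=` hyperplane_union L'.
Proof.
pose c := map_mx (real_complex R) : 'rV[R]_n -> 'rV[R[i]]_n.
exists [seq c l | l <- L & l != 0].
  apply/mapP => -[l]; rewrite mem_filter => /andP[l_neq0 _] /esym/eqP.
  by rewrite map_mx_eq0 (negPf l_neq0).
apply: zariski_closure_hyperplanes => _ [x + <-].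
move=> /boundary_polyhedral_cone[l Ll lx].
exists (c l); first exact: map_f.
by rewrite /dot -map_mxM mxE -/(dot l x) lx rmorph0.
Qed.

Theorem theorem1p4 (R : realType) (n d : nat) (C : set 'cV[R]_n)
  (C_cone : convex_cone C) (C_closed : closed C) (C_full : full_dimensional C)
  (C_smooth : smooth_algebraic_boundary d C)
  (n_ge4 : (4 <= n)%N) (d_ge3 : (3 <= d)%N) (nd_neq : (n, d) <> (4, 4)%N) :
  ~ RG_finitely_generated C.
Proof.
move=> [Rt [G RG_C]]; have [_ _ [G_group _] [GC _] _] := RG_C.
have [f [homf Cf smoothf]] := C_smooth.
have n_gt0 : (0 < n)%N by apply: leq_trans n_ge4.
have finG : finite_set G.
  apply: (torsion_subgroup_finite G_group) => T.
  exact: (subgroup_torsion C_closed G_group GC n_gt0 homf d_ge3 smoothf Cf).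
have [L def_C] := RG_generated_polyhedral C_cone C_full RG_C finG.
have [L' L'_neq0 boundary_L'] := algebraic_boundary_polyhedral L.
apply: (hypersurface_not_in_hyperplanes homf _ _ smoothf L'_neq0).
- exact: ltnW.
- exact: ltnW.
- by move=> z fz; apply: boundary_L'; rewrite -def_C Cf.
Qed.
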